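(* Let $D\subset\mathbb R^d$ be a bounded domain and let $f$ be a Gaussian random field on $D$ with continuous mean function $f_0$ and continuous covariance function $c$. Let $(\sigma_k^2,f_k)_{k\in\mathbb N}$ denote the eigenpairs of its covariance operator on $L^2(D)$, so that $f$ has the Karhunen–Loève expansion $f=f_0+\sum_{k=1}^\infty\sigma_k\xi_kf_k$, and for $K\in\mathbb N$ let $$f_K(x,\omega):=f_0(x)+\sum_{k=1}^K\sigma_k\,\xi_k(\omega)\,f_k(x)$$ be its truncation. Let $P,P_K$ be the resulting distributions of $f$ and $f_K$ on $L^2(D)$. Then $$d_2(P,P_K)=\sqrt{\sum_{k=K+1}^\infty\sigma_k^2},$$ where the Wasserstein distance is taken with respect to the metric induced by the $L^2(D)$-norm.
   Context: Mean and covariance are continuous on (the closure of) the domain. The covariance operator is $C\colon L^2(D)\to L^2(D)$, $C\varphi(x)=\int_Dc(x,y)\varphi(y)\,dy$, a nonnegative self-adjoint trace-class operator; $(f_k)_k$ is an orthonormal basis of $L^2(D)$ of eigenfunctions with $Cf_k=\sigma_k^2f_k$, $\sigma_k\ge0$, and $\xi_k$ are the (uncorrelated, mean-zero, unit-variance, here i.i.d. standard normal) coefficients, $\sigma_k\xi_k=(f-f_0,f_k)_{L^2(D)}$. For Borel probability measures $P,Q$ on $L^2(D)$, $d_2(P,Q)=\inf_\pi(\iint\|x-y\|_{L^2(D)}^2\,\pi(dx,dy))^{1/2}$, the infimum over all Borel probability measures $\pi$ on $L^2(D)\times L^2(D)$ with marginals $P$ and $Q$. *)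

(* Defs.v *)
From HB Require Import structures.
From mathcomp Require Import all_boot all_order all_algebra finmap.
From mathcomp Require Import all_classical all_reals all_analysis.
From mathcomp Require Import measurable_realfun.
Set Implicit Arguments.
Unset Strict Implicit.
Unset Printing Implicit Defensive.
Import Order.TTheory GRing.Theory Num.Theory.
Import numFieldNormedType.Exports.
Local Open Scope classical_set_scope.
Local Open Scope ring_scope.

HB.instance Definition _ (T U : ptopologicalType) := Topological.on (T * U)%type.

Definition borel (T : ptopologicalType) := g_sigma_algebraType (@open T).

HB.instance Definition _ (T : ptopologicalType) := Measurable.on (borel T).

Section image_measure.
Context d1 d2 (T1 : measurableType d1) (T2 : measurableType d2) (R : realType).
Variables (m : {measure set T1 -> \bar R}) (f : {mfun T1 >-> T2}).

Definition image_measure : set T2 -> \bar R := pushforward m f.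

Let image0 : image_measure set0 = 0%E.
Proof. by rewrite /image_measure /pushforward preimage_set0 measure0. Qed.

Let image_ge0 A : (0 <= image_measure A)%E.
Proof. exact: measure_ge0. Qed.

Let image_sigma_additive : semi_sigma_additive image_measure.
Proof. exact: (@measure_semi_sigma_additive _ _ _ (pushforward m f)). Qed.

HB.instance Definition _ :=
  isMeasure.Build _ _ _ image_measure image0 image_ge0 image_sigma_additive.

End image_measure.

Section lebesgue_rV.
Context {R : realType}.
Local Notation RT := (measurableTypeR R).

Definition tuple_row n (t : n.-tuple RT) : borel 'rV[R]_n := \row_i tnth t i.

Lemma measurable_tuple_row n : measurable_fun [set: n.-tuple _] (@tuple_row n).
Proof.
apply: (@measurability _ _ _ (borel _) _ _ (@open 'rV[R]_n)) => // _ [U oU <-].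
rewrite setTI.
pose box (c : {ffun 'I_n -> rat} * nat) : set (n.-tuple RT) :=
  \bigcap_(i in [set: 'I_n])
    ((@tnth n RT)^~ i @^-1` ball (ratr (c.1 i) : R) (c.2.+1%:R^-1)).
have mbox c : measurable (box c).
  apply: fin_bigcap_measurable; first exact: finite_finset.
  move=> i _; rewrite -[X in measurable X]setTI.
  by apply: measurable_tnth => //; exact: measurable_ball.
pose F c := if `[< box c `<=` @tuple_row n @^-1` U >] then box c else set0.
rewrite [X in measurable X](_ : _ = \bigcup_c F c); last first.
  apply/seteqP; split=> [t Ut|t [c _]]; last first.
    by rewrite /F; case: asboolP => // /[apply].
  have /nbhs_ballP[e /= e0 eU] : nbhs (tuple_row t) U by exact: open_nbhs_nbhs.
  have [k ke] : exists k : nat, (k.+1%:R^-1 : R) < e / 2.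
    exists (Num.truncn (e / 2)^-1).
    by rewrite invf_plt ?posrE ?divr_gt0// truncnS_gt.
  have /choice[q tq] : forall i : 'I_n, exists q : rat,
      ball (ratr q : R) (k.+1%:R^-1) (tnth t i : R).
    move=> i; have k0 : 0 < (k.+1%:R^-1 : R) by rewrite invr_gt0.
    have [r [br [q _ qr]]] := @dense_rat R (ball (tnth t i : R) k.+1%:R^-1)
      (ex_intro _ _ (ballxx _ k0)) (ball_open _ _).
    by exists q; rewrite qr; exact: ball_sym.
  pose c := ([ffun i => q i], k); exists c => //.
  have bt : box c t by move=> i _ /=; rewrite ffunE; exact: tq.
  rewrite /F; case: asboolP => // -[] s sbox; apply: eU; split=> // i j.
  have -> : i = ord0 by rewrite (ord1 i).
  rewrite !mxE (splitr e).
  have le2 := le_ball (ltW ke).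
  apply: (@ball_triangle _ _ (ratr (q j) : R)).
    by apply: ball_sym; apply: le2; exact: tq.
  by apply: le2; have := sbox j I; rewrite /= ffunE.
apply: countable_bigcupT_measurable => // c.
by rewrite /F; case: ifP.
Qed.

HB.instance Definition _ n :=
  isMeasurableFun.Build _ _ _ _ (@tuple_row n) (@measurable_tuple_row n).

Definition tuple_consp n (p : RT * n.-tuple RT) : n.+1.-tuple RT :=
  [tuple of p.1 :: p.2].

Lemma measurable_tuple_consp n : measurable_fun [set: _ * _] (@tuple_consp n).
Proof. by apply: measurable_cons. Qed.

HB.instance Definition _ n :=
  isMeasurableFun.Build _ _ _ _ (@tuple_consp n) (@measurable_tuple_consp n).

Section step.
Variables (n : nat) (m : {sigma_finite_measure set (n.-tuple RT) -> \bar R}).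

Definition lebesgue_step : set (n.+1.-tuple RT) -> \bar R :=
  image_measure (lebesgue_measure \x m)%E (@tuple_consp n).

HB.instance Definition _ := Measure.on lebesgue_step.

Lemma lebesgue_step_sigma_finite : sigma_finite setT lebesgue_step.
Proof.
have [F [FT ndF Foo]] :=
  (sigma_finiteP _ _).1 (sigma_finiteT (@lebesgue_measure R)).
have [G [GT ndG Goo]] := (sigma_finiteP _ _).1 (sigma_finiteT m).
pose split (t : n.+1.-tuple RT) := (thead t, [tuple of behead t]).
have msplit : measurable_fun setT split.
  apply: measurable_fun_pair; last exact: measurable_behead.
  exact: measurable_tnth.
exists (fun k => split @^-1` (F k `*` G k)) => [|k].
  apply/esym; rewrite -subTset => t _.
  have [i _ Fi] : (\bigcup_i F i) (thead t) by rewrite -FT.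
  have [j _ Gj] : (\bigcup_i G i) [tuple of behead t] by rewrite -GT.
  exists (maxn i j) => //; split.
    by move: Fi; exact/subsetPset/ndF/leq_maxl.
  by move: Gj; exact/subsetPset/ndG/leq_maxr.
have [mF Fk] := Foo k; have [mG Gk] := Goo k.
have mFG : measurable (F k `*` G k) by exact: measurableX.
split; first by rewrite -[X in measurable X]setTI; exact: msplit.
have -> : lebesgue_step (split @^-1` (F k `*` G k)) =
    (lebesgue_measure \x m)%E (F k `*` G k).
  rewrite /lebesgue_step /image_measure /pushforward -comp_preimage.
  have -> : split \o @tuple_consp n = id.
    by apply/funext => -[a t] /=; congr pair; apply: val_inj.
  by rewrite preimage_id.
have := product_measure1E lebesgue_measure m mF mG.
by move=> ->; rewrite lte_mul_pinfty// ge0_fin_numE.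
Qed.

HB.instance Definition _ :=
  Measure_isSigmaFinite.Build _ _ _ lebesgue_step lebesgue_step_sigma_finite.

End step.

Fixpoint lebesgue_tuple n : {sigma_finite_measure set (n.-tuple RT) -> \bar R} :=
  if n is k.+1 then lebesgue_step (lebesgue_tuple k)
  else \d_([tuple] : 0.-tuple RT).

(* Lebesgue measure on the Borel sets of R^n: the iterated product measure on
   n-tuples, carried over to row vectors. *)
Definition lebesgue_rV n : set (borel 'rV[R]_n) -> \bar R :=
  image_measure (lebesgue_tuple n) (@tuple_row n).

HB.instance Definition _ n := Measure.on (@lebesgue_rV n).

Lemma lebesgue_tuple_box n (a b : 'I_n -> R) : (forall i, a i <= b i) ->
  lebesgue_tuple n
    [set t : n.-tuple RT | forall i, `[a i, b i]%classic (tnth t i)]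
  = (\prod_i (b i - a i))%:E.
Proof.
elim: n a b => [|n IH] a b ab.
  rewrite big_ord0 /= (_ : [set t | _] = setT) ?diracT//.
  by apply/seteqP; split=> t // _ [].
rewrite big_ord_recl EFinM /=.
pose B := [set t : n.-tuple RT |
  forall i, `[a (lift ord0 i), b (lift ord0 i)]%classic (tnth t i)].
have mB : measurable B.
  rewrite (_ : B = \bigcap_(i in [set: 'I_n]) ((@tnth n RT)^~ i @^-1`
     `[a (lift ord0 i), b (lift ord0 i)]%classic)).
    apply: fin_bigcap_measurable; first exact: finite_finset.
    move=> i _; rewrite -[X in measurable X]setTI.
    by apply: measurable_tnth => //; exact: measurable_itv.
  by apply/seteqP; split=> t Bt i *; exact: Bt.
have mI : measurable (`[a ord0, b ord0]%classic : set RT).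
  exact: measurable_itv.
transitivity ((lebesgue_measure \x lebesgue_tuple n)%E
    (`[a ord0, b ord0]%classic `*` B)); last first.
  have -> := product_measure1E lebesgue_measure (lebesgue_tuple n) mI mB.
  congr (_ * _)%E; last exact: IH.
  apply: etrans; first exact: (@lebesgue_measure_itv R `[a ord0, b ord0]).
  rewrite /= lte_fin lt_neqAle ab andbT.
  by case: eqVneq => //= ->; rewrite subrr.
rewrite /lebesgue_step /image_measure /pushforward.
congr (product_measure1 _ _ _).
apply/seteqP; split=> [[r t] /= H|[r t] /= [r0 Bt] i].
  split; first by have := H ord0; rewrite (tnth_nth 0).
  by move=> i; have := H (lift ord0 i); rewrite tnthS.
case: (unliftP ord0 i) => [j ->|->]; last by rewrite (tnth_nth 0).
by rewrite tnthS; exact: Bt.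
Qed.

Lemma lebesgue_rV_box n (a b : 'I_n -> R) : (forall i, a i <= b i) ->
  lebesgue_rV [set x : 'rV[R]_n | forall i, a i <= x 0 i <= b i]
  = (\prod_i (b i - a i))%:E.
Proof.
move=> /lebesgue_tuple_box <-; rewrite /lebesgue_rV /image_measure /pushforward.
congr (lebesgue_tuple _ _); apply/seteqP; split=> t /= H i;
  by have := H i; rewrite /tuple_row mxE in_itv.
Qed.

End lebesgue_rV.

Section L2.
Context d (T : measurableType d) (R : realType).
Variable mu : {measure set T -> \bar R}.

Definition L2 : Type := LspaceType2 mu.

(* A representative of the class u. *)
Definition L2fun (u : L2) : T -> R := (u : LspaceType2 mu).

Coercion L2fun : L2 >-> Funclass.

Lemma measurable_L2fun u : measurable_fun setT (L2fun u).
Proof.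
have mu_ : @measurable_fun _ _ T (measurableTypeR R) setT (L2fun u).
  by rewrite /L2fun /aqEqMfun_to_fun; exact: measurable_funPT.
exact: mu_.
Qed.

Lemma L2fun_Lfun u : L2fun u \in Lfun mu 2%:E.
Proof.
apply/andP; split; rewrite inE /=; first exact: measurable_L2fun.
exact: (@Lebesgue_finite _ _ _ _ _ _ (u : LspaceType2 mu)).
Qed.

Lemma ae_eq_Lnorm2 (f g : T -> R) : measurable_fun setT f ->
  measurable_fun setT g -> f = g %[ae mu] ->
  ('N[mu]_2[EFin \o f] = 'N[mu]_2[EFin \o g])%E.
Proof.
move=> mf mg fg; have m2 (h : T -> R) : measurable_fun setT h ->
    measurable_fun setT (fun x => (`|h x| `^ 2)%:E).
  move=> mh; apply/measurable_EFinP.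
  apply: (@measurableT_comp _ _ _ _ _ _ (fun x : R => x `^ 2)) => //.
  exact: measurableT_comp.
have N2 (h : T -> R) : ('N[mu]_2[EFin \o h] =
    (\int[mu]_x (`|h x| `^ 2)%:E) `^ 2^-1)%E by rewrite Lnorm.unlock.
rewrite (N2 f) (N2 g); apply: (f_equal (fun z => z `^ 2^-1)%E).
apply: (@ge0_ae_eq_integral _ _ _ mu setT (fun x => (`|f x| `^ 2)%:E)
  (fun x => (`|g x| `^ 2)%:E)).
- exact: measurableT.
- exact: (m2 f).
- exact: (m2 g).
- by move=> x _; rewrite lee_fin powR_ge0.
- by move=> x _; rewrite lee_fin powR_ge0.
- exact: (ae_eq_comp (fun r : R => (`|r| `^ 2)%:E) fg).
Qed.

Section pack.
Variables (g : T -> R) (gL : g \in Lfun mu 2%:E).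

Lemma Lfun_measurable : @measurable_fun _ _ T (measurableTypeR R) setT g.
Proof. by move: gL => /andP[]; rewrite !inE. Qed.

Definition Lfun_mfun : {mfun T >-> measurableTypeR R} :=
  HB.pack g (isMeasurableFun.Build _ _ T (measurableTypeR R) g Lfun_measurable).

Definition Lfun_aeclass : {mfun_ mu, T >-> measurableTypeR R} :=
  (\pi_({mfun_ mu, T >-> measurableTypeR R}) Lfun_mfun)%qT.

Lemma Lfun_aeclassE : (Lfun_aeclass : T -> R) = g %[ae mu].
Proof.
rewrite /aqEqMfun_to_fun.
have := reprK Lfun_aeclass; rewrite /Lfun_aeclass.
by move=> /eqmodP/asboolP.
Qed.

Lemma Lfun_aeclass_finite : finite_norm mu 2%:E (Lfun_aeclass : T -> R).
Proof.
rewrite /finite_norm (ae_eq_Lnorm2 _ _ Lfun_aeclassE).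
- by move: gL => /andP[]; rewrite !inE.
- exact: (@measurable_funPT _ _ _ _ (repr Lfun_aeclass)).
- exact: Lfun_measurable.
Qed.

Definition Lfun_L2 : L2 :=
  HB.pack_for (LspaceType2 mu) Lfun_aeclass
    (isFinLebesgue.Build _ _ _ mu _ (lee1n 2) Lfun_aeclass Lfun_aeclass_finite).
End pack.

Lemma L2fun_Lfun_L2 g (gL : g \in Lfun mu 2%:E) :
  L2fun (Lfun_L2 gL) = g %[ae mu].
Proof. exact: Lfun_aeclassE. Qed.

Lemma eq_L2 (u v : L2) : L2fun u = L2fun v %[ae mu] -> u = v.
Proof.
case: u v => [u [[pu]]] [v [[pv]]] uv.
have {}uv : u = v.
  by rewrite -[u]reprK -[v]reprK; apply/eqmodP/asboolP.
by case: _ / uv pv => pv; rewrite (Prop_irrelevance pu pv).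
Qed.

Definition L2dist (u v : L2) : R :=
  fine ('N[mu]_2%:E[EFin \o (L2fun u \- L2fun v)%R])%E.

Let L2sub_Lfun u v : (L2fun u \- L2fun v) \in Lfun mu 2%:E.
Proof. by rewrite rpredB ?lee1n//= => ?; exact: L2fun_Lfun. Qed.

Lemma L2distE u v :
  ((L2dist u v)%:E = 'N[mu]_2%:E[EFin \o (L2fun u \- L2fun v)%R])%E.
Proof.
rewrite fineK// ge0_fin_numE ?Lnorm_ge0//.
by have /andP[_] := L2sub_Lfun u v; rewrite inE.
Qed.

Lemma L2distxx u : L2dist u u = 0.
Proof.
apply: EFin_inj; rewrite L2distE -[RHS](@Lnorm0 _ _ _ mu 2%:E)//.
by apply: eq_Lnorm => x /=; congr EFin; exact: subrr.
Qed.

Lemma L2dist_positivity u v : L2dist u v = 0 -> u = v.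
Proof.
move=> uv0; apply: eq_L2.
have N0 : ('N[mu]_2%:E[EFin \o (L2fun u \- L2fun v)%R] = 0)%E.
  by rewrite -L2distE uv0.
have mf : measurable_fun setT (EFin \o (L2fun u \- L2fun v)).
  by apply/measurable_EFinP; apply: measurable_funB; exact: measurable_L2fun.
have := Lnorm_eq0_eq0 mf _ N0.
rewrite lte_fin ltr0n => /(_ isT).
apply: filterS => x /(_ I) [] /eqP + _.
by rewrite subr_eq0 => /eqP.
Qed.

Lemma L2dist_sym u v : L2dist u v = L2dist v u.
Proof.
apply: EFin_inj; rewrite !L2distE -oppe_Lnorm.
by apply: eq_Lnorm => x /=; congr EFin; rewrite opprB.
Qed.

Lemma L2dist_triangle v u w : L2dist u w <= L2dist u v + L2dist v w.
Proof.
rewrite -lee_fin EFinD !L2distE.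
apply: le_trans (@eminkowski _ _ _ mu (L2fun u \- L2fun v) (L2fun v \- L2fun w)
  2%:E _ _ _).
- rewrite le_eqVlt; apply/orP; left; apply/eqP/eq_Lnorm => x /=.
  by congr EFin; rewrite subrKA.
- by have /andP[] := L2sub_Lfun u v; rewrite inE.
- by have /andP[] := L2sub_Lfun v w; rewrite inE.
- by rewrite lee1n.
Qed.

HB.instance Definition _ := gen_eqMixin L2.
HB.instance Definition _ := gen_choiceMixin L2.
HB.instance Definition _ :=
  isMetric.Build R L2 L2distxx L2dist_positivity L2dist_sym L2dist_triangle.

Lemma cst0_Lfun2 : cst 0 \in Lfun mu 2%:E.
Proof.
apply/andP; split; rewrite inE /=; first exact: measurable_cst.
by apply: finite_norm_cst0; rewrite lee1n.
Qed.

HB.instance Definition _ := isPointed.Build L2 (Lfun_L2 cst0_Lfun2).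

(* Total version of the class map: functions outside of L^2 go to the class
   of 0. *)
Definition L2class (g : T -> R) : L2 :=
  if pselect (g \in Lfun mu 2%:E) is left gL then Lfun_L2 gL
  else Lfun_L2 cst0_Lfun2.

End L2.

Section wasserstein.
Context d (T : measurableType d) (R : realType).
Variable mu : {measure set T -> \bar R}.
Implicit Types P Q : set (borel (L2 mu)) -> \bar R.

Definition coupling P Q (pi : probability (borel (L2 mu * L2 mu)%type) R) :=
  forall A : set (borel (L2 mu)), measurable A ->
    pi (A `*` setT) = P A /\ pi (setT `*` A) = Q A.

(* P and Q are bare set functions, so that the law of a map into L^2 can be
   taken before the map is known to be measurable. A coupling exists only if P
   and Q agree with probability measures on the Borel sets; otherwise the
   infimum is +oo. *)
Definition wasserstein2 P Q : \bar R :=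
  ereal_inf [set sqrte (\int[pi]_z ((mdist z.1 z.2 : R) ^+ 2)%:E)%E
            | pi in coupling P Q].

End wasserstein.

Record bounded_domain (R : realType) (d : nat) := BoundedDomain {
  dom :> set 'rV[R]_d;
  domain_open : open dom;
  domain_connected : connected dom;
  domain_neq0 : dom !=set0;
  domain_bounded : bounded_set dom
}.

Section domain.
Context (R : realType) (d : nat) (D : bounded_domain R d).

Lemma measurable_domain : measurable (D : set (borel 'rV[R]_d)).
Proof. by apply: sub_sigma_algebra; exact: domain_open. Qed.

Definition domain_measure := mrestr (@lebesgue_rV R d) measurable_domain.

HB.instance Definition _ := Measure.on domain_measure.

Notation L2_domain := (L2 domain_measure).

Definition inner (g h : 'rV[R]_d -> R) : R :=
  \int[@lebesgue_rV R d]_(x in D) (g x * h x).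

Definition covariance_operator (c : 'rV[R]_d -> 'rV[R]_d -> R)
  (g : 'rV[R]_d -> R) : 'rV[R]_d -> R := fun x => inner (c x) g.

Definition orthonormal_basis (e : nat -> L2_domain) :=
  (forall i j, inner (e i) (e j) = (i == j)%:R) /\
  (forall u : L2_domain,
    'N[domain_measure]_2%:E[EFin \o (fun x : 'rV[R]_d =>
        u x - \sum_(k < n) inner u (e k) * e k x)%R]%E
      @[n --> \oo] --> 0%E).

(* (sigma k ^ 2, e k) are the eigenpairs, indexed from 0: e k is the usual
   f_(k+1), and the sum over k < K in KL_truncation is the usual sum over
   1 <= k <= K. *)
Definition eigenbasis (c : 'rV[R]_d -> 'rV[R]_d -> R) (sigma : nat -> R)
    (e : nat -> L2_domain) :=
  [/\ forall k, 0 <= sigma k, orthonormal_basis e &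
    forall k, \forall x \ae @lebesgue_rV R d, dom D x ->
      covariance_operator c (e k) x = sigma k ^+ 2 * e k x].

Section random_field.
Context (dO : measure_display) (Omega : measurableType dO).
Variable P : probability Omega R.
Implicit Types f : 'rV[R]_d -> Omega -> R.

(* Constants count as Gaussian; the case s = 0 is separate because
   normal_prob m 0 is not the Dirac measure at m. *)
Definition gaussian_rv (X : Omega -> R) :=
  measurable_fun setT X /\
  exists m s : R, 0 <= s /\ forall A : set R, measurable A ->
    P (X @^-1` A) = if s == 0 then \d_m A else normal_prob m s A.

(* The field is indexed by D: values off D are irrelevant. The second part says
   that the finite-dimensional distributions are Gaussian. *)
Definition gaussian_random_field f :=
  measurable_fun ((D : set (borel 'rV[R]_d)) `*` [set: Omega])
    (fun p : borel 'rV[R]_d * Omega => f p.1 p.2) /\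
  forall n (x : 'I_n -> 'rV[R]_d) (a : 'I_n -> R), (forall i, dom D (x i)) ->
    gaussian_rv (fun w => \sum_(i < n) a i * f (x i) w).

Definition mean_function f (f0 : 'rV[R]_d -> R) :=
  forall x, dom D x -> ('E_P[f x] = (f0 x)%:E)%E.

Definition covariance_function f (c : 'rV[R]_d -> 'rV[R]_d -> R) :=
  forall x y, dom D x -> dom D y -> covariance P (f x) (f y) = (c x y)%:E.

Definition iid_standard_normal (xi : nat -> {RV P >-> R}) :=
  (forall k (A : set R), measurable A ->
    distribution P (xi k) A = normal_prob 0 1 A) /\
  (forall (J : {fset nat}) (A : nat -> set R), (forall k, measurable (A k)) ->
    P (\bigcap_(k in [set` J]) xi k @^-1` A k) =
    (\prod_(k <- J) P (xi k @^-1` A k))%E).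

Definition KL_coefficients f (f0 : 'rV[R]_d -> R) (sigma : nat -> R)
    (e : nat -> L2_domain) (xi : nat -> {RV P >-> R}) :=
  forall k, \forall w \ae P,
    sigma k * xi k w = inner (fun x => f x w - f0 x) (e k).

Definition KL_truncation (f0 : 'rV[R]_d -> R) (sigma : nat -> R)
    (e : nat -> L2_domain) (xi : nat -> {RV P >-> R}) (K : nat) :
    'rV[R]_d -> Omega -> R :=
  fun x w => f0 x + \sum_(k < K) sigma k * xi k w * e k x.

(* The restriction of f to D as an L^2(D)-valued map and its distribution. A
   field with continuous mean and covariance has its paths in L^2(D) almost
   surely, so the default value of L2class is only used on a null set. *)
Definition L2_path f (w : Omega) : borel L2_domain :=
  L2class domain_measure ((fun x => f x w) \_ D).

Definition L2_law f : set (borel L2_domain) -> \bar R :=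
  pushforward P (L2_path f).

End random_field.

End domain.

Arguments L2_path {R d} D {dO Omega} f w.
Arguments L2_law {R d} D {dO Omega} P f.

(* Main.v *)
Require Import Defs.
From HB Require Import structures.
From mathcomp Require Import all_boot all_order all_algebra finmap.
From mathcomp Require Import all_classical all_reals all_analysis.
From mathcomp Require Import measurable_realfun.
From mathcomp Require Import ring lra.
Set Implicit Arguments.
Unset Strict Implicit.
Unset Printing Implicit Defensive.
Import Order.TTheory GRing.Theory Num.Theory.
Import numFieldNormedType.Exports.
Local Open Scope classical_set_scope.
Local Open Scope ring_scope.

(** Every coupling pi of the laws of f and of its truncation f_K is a law of a
    pair (u, v) of elements of L^2(D), and Parseval splits its cost along the
    eigenfunctions:
    the cost of pi is the sum over k of the pi-integral of (<u,e_k> - <v,e_k>)^2.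

    For k >= K the k-th coordinate of f_K is the constant <f0,e_k>, so the k-th
    term only sees the first marginal of pi: it is the variance
    sigma_k^2 of the k-th coordinate of f, whatever the coupling. Hence no
    coupling costs less than the tail of the series of the sigma_k^2. The joint
    law of f and f_K, both built from the same coefficients xi_k, attains this
    bound, because there the coordinates with k < K agree almost surely. This is
    wasserstein2_coordinates.

    The rest of the work makes this argument meaningful. Parseval's identity
    follows from completeness of the basis (parseval). Coordinates are Lipschitz,
    hence Borel (measurable_dotp). Random elements of L^2(D) given by jointly
    measurable functions are Borel maps, also as pairs, since rational
    combinations of the basis are dense (measurable_L2_pair,
    measurable_L2class_dist). The paths of f lie in L^2(D) almost surely since the
    integral of c(x,x) over D is finite (Lfun2_field). The second moment of a
    standard normal variable is 1 by integration by parts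
    (normal_second_moment). *)

(** * Maps into Borel spaces, and tails of series *)

Section borel_maps.
Context (R : realType).

Lemma measurable_preimage_open d (T : measurableType d) (X : ptopologicalType)
    (h : T -> borel X) :
  (forall U : set X, open U -> measurable (h @^-1` U)) ->
  measurable_fun setT h.
Proof.
move=> hU; apply: (@measurability _ _ _ (borel X) _ _ (@open X)) => //.
by move=> _ [U oU <-]; rewrite setTI; exact: hU.
Qed.

Lemma continuous_measurable_borel (X Y : ptopologicalType) (h : X -> Y) :
  continuous h -> measurable_fun setT (h : borel X -> borel Y).
Proof.
move=> ch; apply: measurable_preimage_open => U oU.
by apply: sub_sigma_algebra; exact: open_comp.
Qed.

Lemma measurable_fst_borel (X Y : ptopologicalType) :
  measurable_fun setT (fst : borel (X * Y)%type -> borel X).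
Proof. by apply: continuous_measurable_borel => -[x y]; exact: cvg_fst. Qed.

Lemma measurable_snd_borel (X Y : ptopologicalType) :
  measurable_fun setT (snd : borel (X * Y)%type -> borel Y).
Proof. by apply: continuous_measurable_borel => -[x y]; exact: cvg_snd. Qed.

Lemma continuous_measurable_real (X : ptopologicalType) (h : X -> R) :
  continuous h -> measurable_fun setT (h : borel X -> R).
Proof.
move=> ch; apply: (measurability _ (RGenInftyO.measurableE R)) => //.
move=> _ [_ [x ->] <-]; rewrite setTI.
apply: sub_sigma_algebra; exact: open_comp.
Qed.

Lemma eq_eseries_tail (f g : nat -> \bar R) n :
  (forall k, (n <= k)%N -> f k = g k) ->
  (\sum_(n <= k <oo) f k = \sum_(n <= k <oo) g k)%E.
Proof.
move=> fg; apply/congr_lim/funext => m.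
by apply: eq_big_nat => k /andP[nk _]; exact: fg.
Qed.

End borel_maps.

(** * The scalar product of L^2 *)

Section scalar_product.
Context d (T : measurableType d) (R : realType) (mu : {measure set T -> \bar R}).
Local Notation Lfun2 := (Lfun mu 2%:E).
Implicit Types g h : T -> R.

Definition dotp g h : R := \int[mu]_x (g x * h x).

Lemma Lfun2_measurable g : g \in Lfun2 -> measurable_fun setT g.
Proof. by move=> /andP[]; rewrite inE. Qed.

Lemma Lnorm2E g : ('N[mu]_2[EFin \o g] = sqrte (\int[mu]_x (g x ^+ 2)%:E))%E.
Proof.
rewrite unlock poweR12_sqrt; last first.
  by apply: integral_ge0 => x _; exact: poweR_ge0.
congr sqrte; apply: eq_integral => x _.
by rewrite /= powR_mulrn// real_normK// num_real.
Qed.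

Lemma sqr_int_Lfun2 g : measurable_fun setT g ->
  (\int[mu]_x (g x ^+ 2)%:E < +oo)%E -> g \in Lfun2.
Proof.
move=> mg goo; apply/andP; split; rewrite inE//= /finite_norm Lnorm2E.
by case: (\int[mu]_x _)%E goo => //= r _; rewrite ltry.
Qed.

Lemma Lfun2_sqr_int g : g \in Lfun2 -> (\int[mu]_x (g x ^+ 2)%:E < +oo)%E.
Proof.
move=> /Lfun2_integrable_sqr /integrableP[_]; apply: le_lt_trans.
rewrite le_eqVlt; apply/orP; left; apply/eqP/eq_integral => x _.
by rewrite /= ger0_norm ?sqr_ge0.
Qed.

Lemma dotp_integrable g h : g \in Lfun2 -> h \in Lfun2 ->
  mu.-integrable setT (EFin \o (fun x => g x * h x)).
Proof. by move=> gL hL; apply/Lfun1_integrable; exact: Lfun2_mul_Lfun1. Qed.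

Lemma Lfun2B g h : g \in Lfun2 -> h \in Lfun2 ->
  (fun x => g x - h x) \in Lfun2.
Proof. by move=> gL hL; apply: rpredB => //; rewrite lee1n. Qed.

Lemma Lfun2D g h : g \in Lfun2 -> h \in Lfun2 ->
  (fun x => g x + h x) \in Lfun2.
Proof. by move=> gL hL; apply: rpredD => //; rewrite lee1n. Qed.

Lemma Lfun2Z a g : g \in Lfun2 -> (fun x => a * g x) \in Lfun2.
Proof. by move=> gL; apply: rpredZ => //; rewrite lee1n. Qed.

Lemma Lfun2_sum n (F : nat -> T -> R) : (forall k, F k \in Lfun2) ->
  (fun x => \sum_(k < n) F k x) \in Lfun2.
Proof.
move=> FL; elim: n => [|n IH].
  rewrite (_ : (fun _ => _) = cst 0); first exact: cst0_Lfun2.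
  by apply/funext => x; rewrite big_ord0.
rewrite (_ : (fun _ => _) = (fun x => \sum_(k < n) F k x + F n x)).
  exact: Lfun2D.
by apply/funext => x; rewrite big_ord_recr.
Qed.

Lemma dotpC g h : dotp g h = dotp h g.
Proof. by apply: eq_Rintegral => x _; rewrite mulrC. Qed.

Lemma dotpDl g1 g2 h : g1 \in Lfun2 -> g2 \in Lfun2 -> h \in Lfun2 ->
  dotp (fun x => g1 x + g2 x) h = dotp g1 h + dotp g2 h.
Proof.
move=> g1L g2L hL; rewrite /dotp -RintegralD//; try exact: dotp_integrable.
by apply: eq_Rintegral => x _; rewrite mulrDl.
Qed.

Lemma dotpBl g1 g2 h : g1 \in Lfun2 -> g2 \in Lfun2 -> h \in Lfun2 ->
  dotp (fun x => g1 x - g2 x) h = dotp g1 h - dotp g2 h.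
Proof.
move=> g1L g2L hL; rewrite /dotp -RintegralB//; try exact: dotp_integrable.
by apply: eq_Rintegral => x _; rewrite mulrBl.
Qed.

Lemma dotpZl a g h : g \in Lfun2 -> h \in Lfun2 ->
  dotp (fun x => a * g x) h = a * dotp g h.
Proof.
move=> gL hL; rewrite /dotp -RintegralZl//; last exact: dotp_integrable.
by apply: eq_Rintegral => x _; rewrite mulrA.
Qed.

Lemma dotp_suml n (F : nat -> T -> R) h : (forall k, F k \in Lfun2) ->
  h \in Lfun2 ->
  dotp (fun x => \sum_(k < n) F k x) h = \sum_(k < n) dotp (F k) h.
Proof.
move=> FL hL; elim: n => [|n IH].
  rewrite big_ord0 /dotp /Rintegral integral0_eq// => x _.
  by rewrite big_ord0 mul0r.
rewrite big_ord_recr/= -IH -dotpDl//; last exact: Lfun2_sum.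
by congr dotp; apply/funext => x; rewrite big_ord_recr.
Qed.

Lemma dotp_ae g g' h : measurable_fun setT g -> measurable_fun setT g' ->
  measurable_fun setT h -> g = g' %[ae mu] -> dotp g h = dotp g' h.
Proof.
move=> mg mg' mh gg'; congr fine; apply: ae_eq_integral => //.
- by apply/measurable_EFinP; exact: measurable_funM.
- by apply/measurable_EFinP; exact: measurable_funM.
- by apply: filterS gg' => x gg' /gg' ->.
Qed.

Lemma dotpxx g : g \in Lfun2 -> (dotp g g)%:E = (\int[mu]_x (g x ^+ 2)%:E)%E.
Proof.
move=> gL; rewrite fineK; first by apply: eq_integral => x _; rewrite expr2.
exact: (integrable_fin_num _ (dotp_integrable gL gL)).
Qed.

Lemma Lnorm2_dotp g : g \in Lfun2 ->
  ('N[mu]_2[EFin \o g] = (Num.sqrt (dotp g g))%:E)%E.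
Proof. by move=> gL; rewrite Lnorm2E -dotpxx. Qed.

Lemma dotp_ge0 g : 0 <= dotp g g.
Proof. by apply: Rintegral_ge0 => x _; rewrite -expr2 sqr_ge0. Qed.

Lemma L2dist_sqr (u v : L2 mu) :
  L2dist u v ^+ 2 = dotp (fun x => u x - v x) (fun x => u x - v x).
Proof.
have uvL : (fun x => u x - v x) \in Lfun2 by apply: Lfun2B; exact: L2fun_Lfun.
by rewrite /L2dist Lnorm2_dotp//= sqr_sqrtr// dotp_ge0.
Qed.

Lemma L2classE g : g \in Lfun2 -> L2fun (L2class mu g) = g %[ae mu].
Proof.
by move=> gL; rewrite /L2class; case: pselect => // gL'; exact: L2fun_Lfun_L2.
Qed.

Lemma dotp_L2class g h : g \in Lfun2 -> measurable_fun setT h ->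
  dotp (L2class mu g) h = dotp g h.
Proof.
move=> gL mh; apply: dotp_ae (L2classE gL) => //; first exact: measurable_L2fun.
exact: (Lfun2_measurable gL).
Qed.

End scalar_product.

(** * Expansion in an orthonormal basis, and couplings *)

Section orthonormal_expansion.
Context d (T : measurableType d) (R : realType) (mu : {measure set T -> \bar R}).
Local Notation Lfun2 := (Lfun mu 2%:E).
Variable e : nat -> L2 mu.
Lemma Lfun2_comb n (a : nat -> R) :
  (fun x => \sum_(k < n) a k * e k x) \in Lfun2.
Proof.
apply: (@Lfun2_sum _ _ _ mu n (fun k x => a k * e k x)) => k.
by apply: Lfun2Z; exact: L2fun_Lfun.
Qed.

Hypothesis e_orthonormal : forall i j, dotp mu (e i) (e j) = (i == j)%:R.
Implicit Types g : T -> R.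

Lemma dotp_span n (a : nat -> R) i :
  dotp mu (fun x => \sum_(k < n) a k * e k x) (e i) = if (i < n)%N then a i else 0.
Proof.
rewrite (dotp_suml n (F := fun k x => a k * e k x))//=; last 2 first.
- by move=> k; apply: Lfun2Z; exact: L2fun_Lfun.
- exact: L2fun_Lfun.
under eq_bigr do rewrite dotpZl ?L2fun_Lfun// e_orthonormal.
case: ifPn => [ni|].
  rewrite (bigD1 (Ordinal ni))//= eqxx mulr1 big1 ?addr0// => j ji.
  by rewrite (negbTE (_ : _ != _)) ?mulr0//; apply: contra ji => /eqP <-.
rewrite -leqNgt => ni; rewrite big1// => j _.
by rewrite ltn_eqF ?mulr0// (leq_trans (ltn_ord j)).
Qed.

(** Pythagoras: the partial expansion is orthogonal to the residual. *)
Lemma residual_norm n g : g \in Lfun2 ->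
  let r x := g x - \sum_(k < n) dotp mu g (e k) * e k x in
  dotp mu r r = dotp mu g g - \sum_(k < n) dotp mu g (e k) ^+ 2.
Proof.
move=> gL; set s := fun x => \sum_(k < n) dotp mu g (e k) * e k x.
have eL k : (fun x => dotp mu g (e k) * e k x) \in Lfun2.
  by apply: Lfun2Z; exact: L2fun_Lfun.
have sL : s \in Lfun2 by exact: (Lfun2_sum n eL).
have sh h : h \in Lfun2 ->
    dotp mu s h = \sum_(k < n) dotp mu g (e k) * dotp mu (e k) h.
  move=> hL; rewrite (dotp_suml n eL hL).
  by apply: eq_bigr => k _; rewrite dotpZl// L2fun_Lfun.
have rL : (fun x => g x - s x) \in Lfun2 by exact: Lfun2B.
rewrite /= -[X in dotp _ X _]/(fun x => g x - s x).
rewrite -[X in dotp _ _ X]/(fun x => g x - s x).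
rewrite dotpBl// dotpC dotpBl// [dotp mu s (fun x => _ - _)]dotpC dotpBl//.
have -> : dotp mu s s = dotp mu g s.
  rewrite [RHS]dotpC !sh//; apply: eq_bigr => k _.
  rewrite (dotpC _ (e k) s) (dotpC _ (e k) g); congr (_ * _).
  by have := dotp_span n (fun k => dotp mu g (e k)) k; rewrite ltn_ord.
rewrite subrr subr0 (dotpC _ s) dotpC sh//; congr (_ - _).
by apply: eq_bigr => k _; rewrite expr2 [dotp mu (e k) g]dotpC.
Qed.

Hypothesis e_complete : forall u : L2 mu,
  'N[mu]_2%:E[EFin \o (fun x => u x - \sum_(k < n) dotp mu u (e k) * e k x)%R]%E
    @[n --> \oo] --> 0%E.

(** By completeness the norm computed in residual_norm tends to 0. Completeness
    speaks of classes, so g is first replaced by its class, which has the same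
    scalar products. *)
Lemma parseval g : g \in Lfun2 ->
  (\sum_(0 <= k <oo) (dotp mu g (e k) ^+ 2)%:E = (dotp mu g g)%:E)%E.
Proof.
move=> gL; pose u := Lfun_L2 gL.
have gu : L2fun u = g %[ae mu] by exact: L2fun_Lfun_L2.
have mg := Lfun2_measurable gL.
have uL := L2fun_Lfun u; have mu_ := Lfun2_measurable uL.
have uE h : measurable_fun setT h -> dotp mu u h = dotp mu g h.
  by move=> mh; exact: dotp_ae.
have ue k : dotp mu g (e k) = dotp mu u (e k).
  by rewrite uE//; exact: measurable_L2fun.
have -> : dotp mu g g = dotp mu u u by rewrite uE// dotpC uE.
under eq_eseriesr do rewrite ue.
apply/cvg_lim => //.
have := @e_complete u.
under eq_cvg => n.
  rewrite Lnorm2_dotp; last first.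
    by apply: Lfun2B => //; exact: (Lfun2_comb n (fun k => dotp mu u (e k))).
  rewrite residual_norm//.
  over.
move=> /fine_cvgP[_] /= N0.
have resE n : dotp mu u u - \sum_(k < n) dotp mu u (e k) ^+ 2 =
    Num.sqrt (dotp mu u u - \sum_(k < n) dotp mu u (e k) ^+ 2) *
    Num.sqrt (dotp mu u u - \sum_(k < n) dotp mu u (e k) ^+ 2).
  by rewrite -expr2 sqr_sqrtr// -residual_norm// dotp_ge0.
have {N0 resE} : (dotp mu u u - \sum_(k < n) dotp mu u (e k) ^+ 2) @[n --> \oo]
    --> 0.
  have N1 := cvgM N0 N0; rewrite mulr0 in N1.
  under eq_cvg do rewrite resE.
  exact: N1.
move=> /(cvgB (cvg_cst (dotp mu u u))); rewrite subr0 => H.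
rewrite (_ : (fun n => _) = EFin \o (fun n =>
    dotp mu u u - (dotp mu u u - \sum_(k < n) dotp mu u (e k) ^+ 2))).
  by apply: cvg_EFin; [exact: nearW|exact: H].
by apply/funext => n; rewrite /= subKr sumEFin big_mkord.
Qed.

Lemma L2dist_parseval (u v : L2 mu) :
  ((L2dist u v ^+ 2)%:E =
   \sum_(0 <= k <oo) ((dotp mu u (e k) - dotp mu v (e k)) ^+ 2)%:E)%E.
Proof.
rewrite L2dist_sqr -parseval; last by apply: Lfun2B; exact: L2fun_Lfun.
by apply: eq_eseriesr => k _; rewrite dotpBl//; exact: L2fun_Lfun.
Qed.

(** The square of one coordinate is a single term of the Parseval sum. *)
Lemma dotp_lipschitz (u v : L2 mu) k :
  `|dotp mu u (e k) - dotp mu v (e k)| <= L2dist u v.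
Proof.
rewrite -(@ler_sqr _ `|_|) ?nnegrE//; last by rewrite fine_ge0// Lnorm_ge0.
rewrite real_normK ?num_real// -lee_fin L2dist_parseval.
have ge0 i : (0 <= ((dotp mu u (e i) - dotp mu v (e i)) ^+ 2)%:E)%E.
  by rewrite lee_fin sqr_ge0.
apply: le_trans (nneseries_lim_ge k.+1 (fun i _ _ => ge0 i)).
by rewrite big_nat_recr//= leeDr// sume_ge0.
Qed.

Lemma measurable_dotp k :
  measurable_fun setT (fun u : borel (L2 mu) => dotp mu (u : L2 mu) (e k)).
Proof.
apply: (@continuous_measurable_real _ (L2 mu)) => u A /nbhs_ballP[eps eps0 uA].
apply/nbhs_ballP; exists eps => //= v uv; apply: uA; apply: le_lt_trans.
  exact: dotp_lipschitz.
by move: uv; rewrite ballEmdist.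
Qed.

Let rat_comb (q : seq rat) : L2 mu :=
  L2class mu (fun x => \sum_(k < size q) ratr q`_k * e k x).

(** By Parseval the squared distance splits into the tail of the expansion of u
    and the errors of the first n coordinates; each part is made at most
    eps^2 / 2. *)
Lemma rat_comb_dense (u : L2 mu) eps : 0 < eps ->
  exists q : seq rat, L2dist u (rat_comb q) < eps.
Proof.
move=> eps0.
have sumE : (\sum_(0 <= k <oo) (dotp mu u (e k) ^+ 2)%:E = (dotp mu u u)%:E)%E.
  by apply: parseval => //; exact: L2fun_Lfun.
pose tail n := (\sum_(n <= k <oo) (dotp mu u (e k) ^+ 2)%:E)%E.
have : tail @ \oo --> 0%E.
  apply: nneseries_tail_cvg; first by rewrite sumE ltry.
  by move=> k _; rewrite lee_fin sqr_ge0.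
have e2 : 0 < eps ^+ 2 / 2 by rewrite divr_gt0 ?exprn_gt0.
move=> /fine_cvgP[tfin] /cvgrPdist_lt/(_ _ e2) tlt.
have [n _ /(_ n (leqnn n)) [nfin nlt]] : \forall n \near \oo,
  tail n \is a fin_num /\ `|0 - fine (tail n)| < eps ^+ 2 / 2.
  by near=> n; split; near: n.
(* With this precision, n coordinates contribute at most
   n * del^2 = (n / (n + 1)) * (eps^2 / 2). *)
pose del := Num.sqrt (eps ^+ 2 / 2 / n.+1%:R).
have del0 : 0 < del by rewrite sqrtr_gt0 divr_gt0.
have /choice[q qP] : forall k : nat, exists q : rat,
    `|dotp mu u (e k) - ratr q| < del.
  move=> k; have [r [br [q _ qr]]] := @dense_rat R (ball (dotp mu u (e k)) del)
    (ex_intro _ _ (ballxx _ del0)) (ball_open _ _).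
  by exists q; rewrite qr.
exists (mkseq q n).
have coef k : dotp mu (rat_comb (mkseq q n)) (e k) =
    if (k < n)%N then ratr (q k) else 0.
  rewrite dotp_L2class; [|exact: (Lfun2_comb _ (fun k => ratr (mkseq q n)`_k))|
    exact: measurable_L2fun].
  rewrite (dotp_span _ (fun k => ratr (mkseq q n)`_k)) size_mkseq.
  by case: ifPn => // kn; rewrite nth_mkseq.
rewrite -ltr_sqr ?nnegrE ?(ltW eps0)//; last by rewrite fine_ge0// Lnorm_ge0.
rewrite -lte_fin L2dist_parseval.
rewrite (nneseries_split _ n); last by move=> k _; rewrite lee_fin sqr_ge0.
rewrite add0n [X in (_ + X)%E](_ : _ = tail n); last first.
  by apply: eq_eseries_tail => k nk; rewrite coef ltnNge nk subr0.
rewrite -(fineK nfin) sumEFin -EFinD lte_fin.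
rewrite (splitr (eps ^+ 2)) ler_ltD//; last first.
  by move: nlt; rewrite sub0r normrN; apply: le_lt_trans; exact: ler_norm.
rewrite (@le_trans _ _ (\sum_(0 <= k < n) del ^+ 2))//.
  rewrite big_nat [leRHS]big_nat; apply: ler_sum => k /andP[_ kn].
  rewrite coef kn -real_normK ?num_real//.
  by rewrite ler_sqr ?nnegrE ?(ltW del0)// ltW.
rewrite sumr_const_nat subn0 sqr_sqrtr; last by rewrite divr_ge0// ltW.
apply: (@le_trans _ _ (eps ^+ 2 / 2 / n.+1%:R *+ n.+1)).
  by apply: ler_wpMn2l => //; rewrite divr_ge0// ltW.
by rewrite -mulr_natr divfK.
Unshelve. all: by end_near. Qed.

(** Since L^2 is separable, an open set of pairs is the union of the countably
    many boxes inside it that are products of two balls of the same radius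
    1/(m+1) centred at rational combinations of the basis. This treats the Borel
    sets of the product, on which couplings live; the product of the two Borel
    sigma-algebras does not appear. *)
Lemma measurable_L2_pair dO (Omega : measurableType dO) (F G : Omega -> L2 mu) :
  (forall u, measurable_fun setT (fun w => L2dist (F w) u)) ->
  (forall u, measurable_fun setT (fun w => L2dist (G w) u)) ->
  measurable_fun setT (fun w => (F w, G w) : borel (L2 mu * L2 mu)%type).
Proof.
move=> mF mG; apply: measurable_preimage_open => U oU.
pose box (c : seq rat * seq rat * nat) : set (L2 mu * L2 mu) :=
  [set z | L2dist z.1 (rat_comb c.1.1) < c.2.+1%:R^-1 /\
           L2dist z.2 (rat_comb c.1.2) < c.2.+1%:R^-1].
pose H w := (F w, G w).
have mbox c : measurable (H @^-1` box c).
  have mlt (K : Omega -> L2 mu) q : measurable_fun setT (fun w => L2dist (K w) q) ->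
      measurable [set w | L2dist (K w) q < c.2.+1%:R^-1].
    move=> mK; rewrite -[X in measurable X]setTI.
    rewrite (_ : [set _ | _] = (fun w => L2dist (K w) q) @^-1` `]-oo, c.2.+1%:R^-1[).
      by apply: mK => //; exact: measurable_itv.
    by apply/seteqP; split=> w /=; rewrite in_itv.
  by apply: measurableI; exact: mlt.
pose B c := if `[< box c `<=` U >] then H @^-1` box c else set0.
rewrite [X in measurable X](_ : _ = \bigcup_c B c); last first.
  apply/seteqP; split=> [w Uw|w [c _]]; last first.
    by rewrite /B; case: asboolP => // cU /cU.
  have /nbhs_ballP[eps /= eps0 eU] : nbhs (F w, G w) U by exact: open_nbhs_nbhs.
  have [k ke] : exists k : nat, (k.+1%:R^-1 : R) < eps / 2.
    exists (Num.truncn (eps / 2)^-1).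
    by rewrite invf_plt ?posrE ?divr_gt0// truncnS_gt.
  have k0 : 0 < (k.+1%:R^-1 : R) by rewrite invr_gt0.
  have [p Fp] := rat_comb_dense (F w) k0.
  have [q Gq] := rat_comb_dense (G w) k0.
  exists (p, q, k) => //; rewrite /B; case: asboolP => // -[] -[x y] [/= xp yq].
  have near a b c : L2dist a c < k.+1%:R^-1 -> L2dist b c < k.+1%:R^-1 ->
      ball a eps b.
    move=> ac bc; rewrite ballEmdist /= (le_lt_trans (L2dist_triangle c a b))//.
    by rewrite (splitr eps) ltrD// ?(lt_trans ac)// L2dist_sym (lt_trans bc).
  by apply: eU; split; [exact: near Fp xp|exact: near Gq yq].
apply: countable_bigcupT_measurable => // c.
by rewrite /B; case: ifP.
Qed.

Lemma measurable_coordinate_gap k : measurable_fun setT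
  (fun z : borel (L2 mu * L2 mu)%type =>
    ((dotp mu z.1 (e k) - dotp mu z.2 (e k)) ^+ 2)%:E).
Proof.
apply/measurable_EFinP; apply: measurable_funX; apply: measurable_funB.
  exact: (measurableT_comp (measurable_dotp k) (@measurable_fst_borel _ _)).
exact: (measurableT_comp (measurable_dotp k) (@measurable_snd_borel _ _)).
Qed.

Lemma coupling_cost (pi : probability (borel (L2 mu * L2 mu)%type) R) :
  (\int[pi]_z (L2dist z.1 z.2 ^+ 2)%:E = \sum_(0 <= k <oo)
     \int[pi]_z ((dotp mu z.1 (e k) - dotp mu z.2 (e k)) ^+ 2)%:E)%E.
Proof.
rewrite -integral_nneseries//.
- apply: eq_integral => z _.
  exact: L2dist_parseval.
- exact: measurable_coordinate_gap.
- by move=> k z _; rewrite lee_fin sqr_ge0.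
Qed.

Section coupled_maps.
Context dO (Omega : measurableType dO) (P : probability Omega R).
Variables F G : Omega -> borel (L2 mu).
Let FG w : borel (L2 mu * L2 mu)%type := (F w, G w).
Hypothesis mFG : measurable_fun setT FG.

Let mF : measurable_fun setT F.
Proof. exact: (measurableT_comp (@measurable_fst_borel _ _) mFG). Qed.

(** The value is the same for all couplings. *)
Lemma coupling_integral_fst (Q : set (borel (L2 mu)) -> \bar R)
    (pi : probability (borel (L2 mu * L2 mu)%type) R) (h : borel (L2 mu) -> \bar R) :
  coupling (pushforward P F) Q pi ->
  measurable_fun setT h -> (forall u, 0 <= h u)%E ->
  (\int[pi]_z h z.1 = \int[P]_w h (F w))%E.
Proof.
move=> cpl mh h0.
pose fst_ : borel (L2 mu * L2 mu)%type -> borel (L2 mu) := fst.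
have mfst : measurable_fun setT fst_ by exact: measurable_fst_borel.
transitivity (\int[pushforward pi fst_]_u h u)%E.
  by rewrite (ge0_integral_pushforward mfst).
transitivity (\int[pushforward P F]_u h u)%E; last first.
  by rewrite (ge0_integral_pushforward mF).
apply: eq_measure_integral => A mA _.
rewrite /= {1}/pushforward -(cpl A mA).1; congr (pi _).
by apply/seteqP; split=> z //= [].
Qed.

(** The second coordinate is constant pi-almost everywhere, because the
    second marginal of pi is the law of G; replacing it by the constant a leaves
    an integral against the first marginal. *)
Lemma coupling_constant_coordinate (a s : R)
    (pi : probability (borel (L2 mu * L2 mu)%type) R) k :
  (forall w, dotp mu (G w) (e k) = a) ->
  (\int[P]_w ((dotp mu (F w) (e k) - a) ^+ 2)%:E = (s)%:E)%E ->
  coupling (pushforward P F) (pushforward P G) pi ->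
  (\int[pi]_z ((dotp mu z.1 (e k) - dotp mu z.2 (e k)) ^+ 2)%:E = (s)%:E)%E.
Proof.
move=> Ga Fs cpl; rewrite -Fs.
have mh : measurable_fun setT
    (fun u : borel (L2 mu) => ((dotp mu (u : L2 mu) (e k) - a) ^+ 2)%:E).
  apply/measurable_EFinP; apply: measurable_funX; apply: measurable_funB => //.
  exact: measurable_dotp.
rewrite -(coupling_integral_fst cpl mh); last first.
  by move=> u; rewrite lee_fin sqr_ge0.
pose B : set (borel (L2 mu)) := [set u | dotp mu (u : L2 mu) (e k) != a].
have mB : measurable B.
  rewrite (_ : B = (fun u : borel (L2 mu) => dotp mu (u : L2 mu) (e k)) @^-1`
      (~` [set a])).
    rewrite -[X in measurable X]setTI; apply: measurable_dotp => //.
    by apply: measurableC; exact: measurable_set1.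
  by apply/seteqP; split=> u /= /eqP.
apply: ge0_ae_eq_integral => //.
- exact: measurable_coordinate_gap.
- exact: (measurableT_comp mh (@measurable_fst_borel _ _)).
- by move=> z _; rewrite lee_fin sqr_ge0.
- by move=> z _; rewrite lee_fin sqr_ge0.
exists (setT `*` B); split.
- rewrite setTX -[X in measurable X]setTI.
  exact: measurable_snd_borel.
- apply: (etrans (cpl B mB).2).
  rewrite /pushforward (_ : _ @^-1` _ = set0) ?measure0//.
  by apply/seteqP; split=> w //=; rewrite /B /= Ga eqxx.
move=> z /= /not_implyP[_ zE]; split => //; apply/eqP => za.
by apply: zE; rewrite za.
Qed.

(** Split the cost at K: from K on, the terms are s k for every coupling; the
    first K terms are nonnegative for every coupling and vanish for the joint law
    of F and G. *)
Lemma wasserstein2_coordinates (K : nat) (a s : nat -> R) :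
  (forall k w, (K <= k)%N -> dotp mu (G w) (e k) = a k) ->
  (forall k, (K <= k)%N ->
     (\int[P]_w ((dotp mu (F w) (e k) - a k) ^+ 2)%:E = (s k)%:E)%E) ->
  (forall k, (k < K)%N ->
     \forall w \ae P, dotp mu (F w) (e k) = dotp mu (G w) (e k)) ->
  wasserstein2 (pushforward P F) (pushforward P G) =
  sqrte (\sum_(K <= k <oo) (s k)%:E)%E.
Proof.
move=> Ga Fs FG0.
have tailE pi : coupling (pushforward P F) (pushforward P G) pi ->
    (\int[pi]_z (L2dist z.1 z.2 ^+ 2)%:E = (\sum_(0 <= k < K)
       \int[pi]_z ((dotp mu z.1 (e k) - dotp mu z.2 (e k)) ^+ 2)%:E) +
     \sum_(K <= k <oo) (s k)%:E)%E.
  move=> cpl; rewrite coupling_cost (nneseries_split 0 K).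
    congr (_ + _)%E; apply: eq_eseries_tail => k Kk.
    by apply: (@coupling_constant_coordinate (a k)) cpl => [w|]; [exact: Ga|exact: Fs].
  by move=> k _; apply: integral_ge0 => z _; rewrite lee_fin sqr_ge0.
apply/eqP; rewrite eq_le; apply/andP; split; last first.
  apply: le_ereal_inf_tmp => _ [pi cpl <-]; rewrite lee_sqrt; last first.
    by apply: integral_ge0 => z _; rewrite lee_fin sqr_ge0.
  rewrite tailE// leeDr// sume_ge0// => k _.
  by apply: integral_ge0 => z _; rewrite lee_fin sqr_ge0.
pose X : {mfun Omega >-> borel (L2 mu * L2 mu)%type} :=
  HB.pack FG (isMeasurableFun.Build _ _ _ _ FG mFG).
have cpl : coupling (pushforward P F) (pushforward P G) (distribution P X).
  move=> A mA; split; rewrite /distribution/= /pushforward; congr (P _);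
    by apply/seteqP; split=> w //= [].
apply: ge_ereal_inf; exists (sqrte (\sum_(K <= k <oo) (s k)%:E)%E) => //.
exists (distribution P X) => //; rewrite tailE// big_nat big1 ?add0e//.
move=> k /andP[_ kK]; rewrite ge0_integral_distribution; last 2 first.
- exact: measurable_coordinate_gap.
- by move=> z; rewrite lee_fin sqr_ge0.
rewrite -[RHS](integral0 P setT); apply: ge0_ae_eq_integral => //.
- exact: (measurableT_comp (measurable_coordinate_gap k) mFG).
- by move=> w _ /=; rewrite lee_fin sqr_ge0.
- by apply: filterS (FG0 k kK) => w /= -> _; rewrite subrr expr0n.
Qed.

End coupled_maps.

End orthonormal_expansion.

(** * Random functions as random elements of L^2 *)

Section random_L2_class.
Context d (T : measurableType d) (R : realType).
Context (mu : {sigma_finite_measure set T -> \bar R}).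
Context dO (Omega : measurableType dO).

Lemma measurable_sqr_integral (g : T -> Omega -> R) :
  measurable_fun setT (fun p : T * Omega => g p.1 p.2) ->
  measurable_fun setT (fun w => \int[mu]_x (g x w ^+ 2)%:E)%E.
Proof.
move=> mg; apply: (@measurable_fun_fubini_tonelli_G _ _ _ _ _ mu
  (fun p : T * Omega => (g p.1 p.2 ^+ 2)%:E)).
  by apply/measurable_EFinP; exact: measurable_funX.
by move=> p; rewrite lee_fin sqr_ge0.
Qed.

(** On the measurable set of those w whose section is square-integrable the
    distance is an integral depending measurably on w, by Tonelli; elsewhere the
    class is the default value, and the distance is constant. *)
Lemma measurable_L2class_dist (g : T -> Omega -> R) (u : L2 mu) :
  measurable_fun setT (fun p : T * Omega => g p.1 p.2) ->
  measurable_fun setT (fun w => L2dist (L2class mu (g ^~ w)) u).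
Proof.
move=> mg.
have mgw w : measurable_fun setT (g ^~ w).
  exact: (measurable_fun_pair1 w mg).
pose N w := (\int[mu]_x (g x w ^+ 2)%:E)%E.
have NP w : (g ^~ w \in Lfun mu 2%:E) = (N w < +oo)%E.
  by apply/idP/idP => [/Lfun2_sqr_int//|]; exact: sqr_int_Lfun2.
have -> : (fun w => L2dist (L2class mu (g ^~ w)) u) = fun w =>
    if (N w < +oo)%E
    then Num.sqrt (fine (\int[mu]_x ((g x w - u x) ^+ 2)%:E)%E)
    else L2dist (Lfun_L2 (cst0_Lfun2 mu)) u.
  apply/funext => w; rewrite -NP; case: ifPn => gL; last first.
    by rewrite /L2class; case: pselect => // gL'; rewrite gL' in gL.
  have gu := L2classE gL; have mL := @measurable_L2fun _ _ _ mu.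
  have mgu : measurable_fun setT (fun x => g x w - u x).
    by apply: measurable_funB => //; exact: mgw.
  have mLu : measurable_fun setT (fun x => L2class mu (g ^~ w) x - u x).
    by apply: measurable_funB.
  have ae : (fun x => L2class mu (g ^~ w) x - u x) = (fun x => g x w - u x) %[ae mu].
    by apply: filterS gu => x + _ => /(_ I) ->.
  rewrite -[LHS]ger0_norm -?sqrtr_sqr; last by rewrite fine_ge0// Lnorm_ge0.
  rewrite L2dist_sqr (dotp_ae mLu mgu mLu ae) dotpC (dotp_ae mLu mgu mgu ae).
  by congr (Num.sqrt (fine _)); apply: eq_integral => x _; rewrite expr2.
apply: measurable_fun_ifT => //.
- by apply: measurable_fun_lte => //; exact: measurable_sqr_integral.
- apply: (measurableT_comp (@continuous_measurable_fun _ _ (@sqrt_continuous R))).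
  apply: measurableT_comp => //.
  apply: (@measurable_sqr_integral (fun x w => g x w - u x)).
  apply: measurable_funB => //.
  by apply: measurableT_comp => //; exact: measurable_L2fun.
Qed.

End random_L2_class.

(** * The second moment of the standard normal law *)

Section standard_normal.
Context (R : realType).
Local Notation leb := (@lebesgue_measure R).
Let phi : R -> R := normal_pdf 0 1.

Let phiE : phi = fun x => phi 0 * expR (- (x ^+ 2 / 2)).
Proof.
apply/funext => x; rewrite /phi /normal_pdf oner_eq0 /normal_fun.
by rewrite !subr0 expr0n expr1n oppr0 mul0r expR0 mulr1 mulNr.
Qed.

Let continuous_phi : continuous phi.
Proof. by apply: continuous_normal_pdf; exact: oner_neq0. Qed.

Let is_derive_phi (x : R) : is_derive x 1 phi (- (x * phi x)).
Proof.
rewrite [in X in is_derive _ _ X _]phiE.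
apply: is_derive_eq; rewrite [in RHS]phiE.
rewrite /= /GRing.scale/= !mulr0 add0r !mulr1 -mulr2n -[x *+ 2]mulr_natl.
by rewrite mulKf//; ring.
Qed.

(** Integration by parts of x * (x phi x), where - phi is a primitive of x phi. *)
Let sqr_phi_itv n : (0 < n)%N ->
  (\int[leb]_(x in `[0%R, n%:R]) (x ^+ 2 * phi x)%:E =
   \int[leb]_(x in `[0%R, n%:R]) (phi x)%:E - (n%:R * phi n%:R)%:E)%E.
Proof.
move=> n0.
have cG : continuous (fun x => - phi x).
  by move=> x; apply: cvgN; exact: continuous_phi.
under eq_integral do rewrite expr2 -mulrA.
have := @integration_by_parts R id (fun x => - phi x) (cst 1)
  (fun x => x * phi x) 0 n%:R.
rewrite ltr0n n0 => /(_ isT) -> //=.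
- rewrite mul0r subr0 mulrN addeC; congr (_ + _)%E.
  under eq_integral do rewrite mul1r EFinN.
  by rewrite integral_ge0N ?oppeK// => x _; rewrite lee_fin normal_pdf_ge0.
- by apply: continuous_subspaceT => x; exact: cvg_cst.
- split; first by move=> x _; exact: derivable_id.
    by apply: cvg_at_right_filter; exact: cvg_id.
  by apply: cvg_at_left_filter; exact: cvg_id.
- by move=> x _; rewrite derive1E derive_id.
- apply: continuous_subspaceT => x.
  by apply: cvgM; [exact: cvg_id|exact: continuous_phi].
- split.
  + by move=> x _; apply: derivableN; exact: (@ex_derive _ _ _ _ _ _ _ (is_derive_phi x)).
  + by apply: cvg_at_right_filter; exact: cG.
  + by apply: cvg_at_left_filter; exact: cG.
- move=> x _; rewrite derive1E deriveN; last first.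
    exact: (@ex_derive _ _ _ _ _ _ _ (is_derive_phi x)).
  by rewrite (@derive_val _ _ _ _ _ _ _ (is_derive_phi x)) opprK.
Qed.

(** The bound exp y >= 1 + y with y = n^2 / 2 suffices. *)
Let cvg_n_phi : (n%:R * phi n%:R) @[n --> \oo] --> 0.
Proof.
apply: (@squeeze_cvgr _ _ _ _ (cst 0) (fun n => phi 0 * 4 * n.+1%:R^-1)).
- apply: nearW => n; rewrite mulr_ge0 ?normal_pdf_ge0//=.
  have c0 : 0 <= phi 0 by exact: normal_pdf_ge0.
  have -> : phi n%:R = phi 0 * expR (- (n%:R ^+ 2 / 2)) by rewrite {1}phiE.
  rewrite mulrCA -mulrA ler_wpM2l// expRN.
  have n0 : 0 <= (n%:R : R) by [].
  have m0 : 0 < 1 + (n%:R : R) by rewrite ltr_wpDr.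
  have e0 : 0 < 1 + (n%:R : R) ^+ 2 / 2.
    by rewrite ltr_wpDr// divr_ge0// sqr_ge0.
  apply: (@le_trans _ _ (n%:R / (1 + n%:R ^+ 2 / 2))).
    by rewrite ler_wpM2l// lef_pV2 ?posrE ?expR_gt0// expR_ge1Dx.
  rewrite -nat1r ler_pdivrMr// mulrAC ler_pdivlMr//.
  (* n (1 + n) <= 4 (1 + n^2 / 2): the difference is a square plus a
     positive constant. *)
  rewrite -subr_ge0.
  rewrite (_ : _ - _ = (n%:R - 2^-1) ^+ 2 + (4 - 4^-1)); last by field.
  by rewrite addr_ge0 ?sqr_ge0//; lra.
- exact: cvg_cst.
- rewrite -[X in _ --> X](mulr0 (phi 0 * 4)).
  by apply: cvgM; [exact: cvg_cst|exact: cvg_harmonic].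
Qed.

(** On [0, n] the integrals of x^2 phi and of phi differ by the boundary term
    n phi n, which tends to 0. So they agree on the half-line, and both functions
    are even. *)
Lemma normal_second_moment :
  (\int[leb]_x (x ^+ 2 * normal_pdf 0 1 x)%:E = 1)%E.
Proof.
rewrite -/phi -(integral_normal_pdf 0 1).
have even : phi =1 phi \o -%R by move=> x; rewrite phiE /= sqrrN.
have phi0 x : 0 <= phi x by exact: normal_pdf_ge0.
have sqphi0 x : 0 <= x ^+ 2 * phi x by rewrite mulr_ge0 ?sqr_ge0.
have mphi : measurable_fun setT phi by exact: measurable_normal_pdf.
have csq : continuous (fun x : R => x ^+ 2 * phi x).
  by move=> x; apply: cvgM; [exact: exprn_continuous|exact: continuous_phi].
have msq : measurable_fun setT (fun x : R => x ^+ 2 * phi x).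
  exact: continuous_measurable_fun.
rewrite ge0_symfun_integralT//; last first.
  by move=> x /=; rewrite sqrrN; congr (_ * _); exact: even.
rewrite [RHS]ge0_symfun_integralT//; congr (_ * _)%E.
rewrite -set_itvcy.
have c1 := @ge0_cvgn_integral R leb _ phi0 mphi.
have c2 := @ge0_cvgn_integral R leb _ sqphi0 msq.
have c3 : (\int[leb]_(x in `[0%R, n%:R]) (x ^+ 2 * phi x)%:E)%E @[n --> \oo] -->
    (\int[leb]_(x in `[0%R, +oo[) (phi x)%:E)%E.
  rewrite -[X in _ --> X]sube0.
  have c0 : (EFin \o (fun n : nat => n%:R * phi n%:R)) @ \oo --> 0%E.
    by apply: cvg_EFin; [exact: nearW|exact: cvg_n_phi].
  apply: cvg_trans (cvgeB _ c1 c0); last by rewrite fin_num_adde_defl.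
  by apply: near_eq_cvg; exists 1%N => // n n1 /=; rewrite sqr_phi_itv.
by rewrite (cvg_unique _ c2 c3).
Qed.

End standard_normal.

(** The density is the Radon-Nikodym derivative, up to a null set. *)
Lemma normal_prob_integral (R : realType) (m s : R) (f : R -> \bar R) :
  measurable_fun setT f -> (forall x, 0 <= f x)%E ->
  (\int[normal_prob m s]_x f x =
   \int[lebesgue_measure]_x (f x * (normal_pdf m s x)%:E))%E.
Proof.
move=> mf f0; have dom := normal_prob_dominates m s.
have fE := Radon_Nikodym_SigmaFinite.f_integral dom.
have fI := Radon_Nikodym_SigmaFinite.f_integrable dom.
rewrite -(Radon_Nikodym_SigmaFinite.change_of_variables dom)//.
apply: ae_eq_integral => //.
- apply: emeasurable_funM => //; exact: measurable_int fI.
- apply: emeasurable_funM => //; apply/measurable_EFinP.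
  exact: measurable_normal_pdf.
- apply: ae_eqe_mul2l; apply: integral_ae_eq => //.
  + by apply/measurable_EFinP; exact: measurable_normal_pdf.
  + by move=> E _ mE; rewrite -fE.
Qed.

Lemma standard_normal_sqr d (T : measurableType d) (R : realType)
    (P : probability T R) (X : {RV P >-> R}) :
  (forall A : set R, measurable A -> distribution P X A = normal_prob 0 1 A) ->
  (\int[P]_w (X w ^+ 2)%:E = 1)%E.
Proof.
(* The normal law is a measure for the sigma-algebra generated by half-open
   intervals, the structure of measurableTypeR. *)
move=> XN; pose X' : T -> measurableTypeR R := X.
have mX' : measurable_fun setT X' by exact: (measurable_funPT X).
have msq : measurable_fun setT (fun x : measurableTypeR R => ((x : R) ^+ 2)%:E).
  by apply/measurable_EFinP; exact: exprn_measurable.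
transitivity (\int[pushforward P X']_y ((y : R) ^+ 2)%:E)%E.
  rewrite (ge0_integral_pushforward mX')// => y _.
  by rewrite lee_fin sqr_ge0.
transitivity (\int[normal_prob 0 1]_y ((y : R) ^+ 2)%:E)%E.
  by apply: eq_measure_integral => A mA _; exact: XN.
rewrite normal_prob_integral// ?normal_second_moment// => y.
by rewrite lee_fin sqr_ge0.
Qed.

(** * The measure of a bounded domain *)

Section domain_facts.
Context (R : realType) (d : nat) (D : bounded_domain R d).
Local Notation mu := (domain_measure D).

Let box (M : R) : set 'rV[R]_d := [set v | forall i, - M <= v 0 i <= M].

Let box_compact M : compact (box M).
Proof.
have := @rV_compact R d (fun=> `[- M, M]%classic) (fun=> @segment_compact R _ _).
by rewrite (_ : [set _ | _] = box M).
Qed.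

Let box_closed M : closed (box M).
Proof. by apply: compact_closed; [exact: norm_hausdorff|exact: box_compact]. Qed.

Let domain_box : exists2 M, 0 <= M & dom D `<=` box M.
Proof.
have [M [Mreal DM]] := domain_bounded D.
have M1 : M < `|M| + 1 by rewrite (le_lt_trans (ler_norm M))// ltrDl.
exists (`|M| + 1) => [|v /(DM _ M1) vM i]; first by rewrite addr_ge0.
rewrite -ler_norml; apply: le_trans vM.
rewrite [leRHS]/Num.norm /= mx_normrE; apply/bigmax_geP; right => /=.
by exists (0, i).
Qed.

Lemma closure_domain_compact : compact (closure D).
Proof.
have [M _ DM] := domain_box.
apply: (subclosed_compact _ (box_compact (M := M))); first exact: closed_closure.
by rewrite ((closure_id (box M)).1 (@box_closed M)); exact: closure_subset.
Qed.

Lemma domain_measure_lty : (mu setT < +oo)%E.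
Proof.
have [M M0 DM] := domain_box.
rewrite /= /domain_measure /mrestr setTI.
have mbox : measurable (box M : set (borel 'rV[R]_d)).
  rewrite -[box M]setCK; apply: measurableC; apply: sub_sigma_algebra.
  by apply: closed_openC; exact: box_closed.
apply: (@le_lt_trans _ _ (lebesgue_rV (box M))).
  by apply: le_measure => //; rewrite inE//; exact: measurable_domain.
rewrite (@lebesgue_rV_box R d (fun=> - M) (fun=> M)) ?ltry// => i.
by rewrite (le_trans _ M0)// oppr_le0.
Qed.

HB.instance Definition _ :=
  @Measure_isFinite.Build _ _ _ mu (lty_fin_num_fun domain_measure_lty).

(** The values of g off D do not enter the left-hand side; the restriction makes
    this visible to the measure of D, which is defined on the whole space. *)
Lemma inner_dotp g h : inner D g h = dotp mu (g \_ D) h.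
Proof.
rewrite /inner /dotp /Rintegral; congr fine.
transitivity (\int[mu]_(x in D) (g x * h x)%:E)%E.
  apply: eq_measure_integral => A mA AD.
  by rewrite /= /domain_measure /mrestr; congr (lebesgue_rV _); rewrite setIidl.
rewrite [LHS]integral_mkcond; congr integral; apply/funext => x.
by rewrite !patchE; case: ifPn => //; rewrite mul0r.
Qed.

Lemma ae_eq_restrict (g : 'rV[R]_d -> R) : g \_ D = g %[ae mu].
Proof.
exists (~` dom D); split.
- by apply: measurableC; exact: measurable_domain.
- by rewrite /= /domain_measure /mrestr setICl measure0.
- move=> x /= /not_implyP[_ gx] Dx; apply: gx.
  by rewrite patchE mem_set.
Qed.

Lemma dotp_restrict g (h : 'rV[R]_d -> R) :
  measurable_fun setT (g : borel 'rV[R]_d -> R) ->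
  measurable_fun setT (h : borel 'rV[R]_d -> R) ->
  dotp mu (g \_ D) h = dotp mu g h.
Proof.
move=> mg mh; apply: (dotp_ae _ mg mh (@ae_eq_restrict g)).
apply: (measurable_restrictT (g : borel _ -> R) (measurable_domain D)).1.
exact: measurable_funTS.
Qed.

Lemma Lfun2_restrict g : g \in Lfun mu 2%:E -> g \_ D \in Lfun mu 2%:E.
Proof.
move=> gL; have mg := Lfun2_measurable gL.
have mgD : measurable_fun setT (g \_ D : borel 'rV[R]_d -> R).
  apply: (measurable_restrictT (g : borel _ -> R) (measurable_domain D)).1.
  exact: measurable_funTS.
apply: sqr_int_Lfun2 => //; apply: le_lt_trans (Lfun2_sqr_int gL).
apply: ge0_le_integral => //.
- by move=> x _; rewrite lee_fin sqr_ge0.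
- by apply/measurable_EFinP; exact: measurable_funX.
- by apply/measurable_EFinP; exact: measurable_funX.
- move=> x _; rewrite lee_fin patchE; case: ifPn => // _.
  by rewrite expr0n sqr_ge0.
Qed.

End domain_facts.
Arguments closure_domain_compact {R d} D.
Arguments dotp_restrict {R d D g h}.

(** * Gaussian fields and their truncations in coordinates *)

Lemma compact_continuous_bounded (T : topologicalType) (R : realType)
    (A : set T) (g : T -> R) : compact A -> {within A, continuous g} ->
  exists M, forall x, A x -> `|g x| <= M.
Proof.
move=> cA cg; have [M [_ gM]] := compact_bounded (continuous_compact cg cA).
exists (M + 1) => x Ax; apply: (gM (M + 1)); first by rewrite ltrDl.
by exists x.
Qed.

Section field_on_domain.
Context (R : realType) (d : nat) (D : bounded_domain R d).
Local Notation mu := (domain_measure D).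

Lemma measurable_restrict_domain (g : 'rV[R]_d -> R) :
  {within closure D, continuous g} ->
  measurable_fun setT (g \_ D : borel 'rV[R]_d -> R).
Proof.
move=> cg.
apply: (measurable_restrictT (g : borel 'rV[R]_d -> R) (measurable_domain D)).1.
have {}cg : {in dom D, continuous g}.
  rewrite -continuous_open_subspace; last exact: domain_open.
  by apply: continuous_subspaceW cg; exact: subset_closure.
apply: (measurability _ (RGenInftyO.measurableE R)) => //.
move=> _ [_ [x ->] <-].
suff : open (dom D `&` g @^-1` `]-oo, x[%classic) by exact: sub_sigma_algebra.
rewrite openE => y [Dy gy]; rewrite /interior.
have /cg gcont : y \in dom D by rewrite inE.
apply: filterI; first by apply: open_nbhs_nbhs; split => //; exact: domain_open.
by apply: gcont; apply: open_nbhs_nbhs; split => //; exact: interval_open.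
Qed.

Lemma Lfun2_restrict_domain (g : 'rV[R]_d -> R) :
  {within closure D, continuous g} -> g \_ D \in Lfun mu 2%:E.
Proof.
move=> cg; have mg := measurable_restrict_domain cg.
have [M gM] := compact_continuous_bounded (closure_domain_compact D) cg.
apply: sqr_int_Lfun2 => //.
apply: (@le_lt_trans _ _ (\int[mu]_x (cst (M ^+ 2)%:E x))%E).
  apply: ge0_le_integral => //.
  - by move=> x _; rewrite lee_fin sqr_ge0.
  - by apply/measurable_EFinP; exact: measurable_funX.
  - move=> x _; rewrite lee_fin -real_normK ?num_real// patchE.
    have gMx : dom D x -> `|g x| <= M by move=> Dx; apply: gM; exact: subset_closure.
    case: ifPn => [/set_mem /gMx gx|_]; last by rewrite normr0 expr0n sqr_ge0.
    by rewrite ler_sqr ?nnegrE// (le_trans _ gx).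
rewrite integral_cst// lte_mul_pinfty ?lee_fin ?sqr_ge0//.
exact: domain_measure_lty.
Qed.

Context (dO : measure_display) (Omega : measurableType dO).
Variable P : probability Omega R.
Variables (f : 'rV[R]_d -> Omega -> R) (f0 : 'rV[R]_d -> R).
Variable c : 'rV[R]_d -> 'rV[R]_d -> R.

Lemma covariance_sqr x : mean_function D P f f0 -> covariance_function D P f c ->
  dom D x -> (\int[P]_w ((f x w - f0 x) ^+ 2)%:E = (c x x)%:E)%E.
Proof.
move=> fm fc Dx; rewrite -fc// covariance.unlock fm// unlock.
by apply: eq_integral => w _ /=; rewrite expr2.
Qed.

Hypothesis mf : measurable_fun ((D : set (borel 'rV[R]_d)) `*` [set: Omega])
  (fun p : borel 'rV[R]_d * Omega => f p.1 p.2).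

Lemma measurable_field_restrict : measurable_fun setT
  (fun p : borel 'rV[R]_d * Omega => ((f ^~ p.2) \_ D) p.1).
Proof.
have mD : measurable ((D : set (borel 'rV[R]_d)) `*` [set: Omega]).
  by apply: measurableX => //; exact: measurable_domain.
rewrite (_ : (fun _ => _) = (fun p : borel 'rV[R]_d * Omega => f p.1 p.2) \_
  ((D : set (borel 'rV[R]_d)) `*` [set: Omega])).
  exact/(measurable_restrictT _ mD).
apply/funext => -[x w] /=; rewrite !patchE.
by congr (if _ then _ else _); apply/idP/idP; rewrite !inE => //= -[].
Qed.

Hypothesis f0_cont : {within closure D, continuous f0}.

(** By Tonelli the expected squared norm of f - f0 is the integral of the variance
    c(x,x) over D. It is finite, since c is bounded on the compact closure and D
    has finite measure, so almost every path of f - f0 is square-integrable. *)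
Lemma Lfun2_field :
  mean_function D P f f0 -> covariance_function D P f c ->
  {within closure D `*` closure D,
    continuous (fun p : 'rV[R]_d * 'rV[R]_d => c p.1 p.2)} ->
  \forall w \ae P, (f ^~ w) \_ D \in Lfun mu 2%:E.
Proof.
move=> fm fc cc.
have mf0 := measurable_restrict_domain f0_cont.
have mfD := measurable_field_restrict.
pose h (p : borel 'rV[R]_d * Omega) := ((f ^~ p.2) \_ D) p.1 - (f0 \_ D) p.1.
have mh : measurable_fun setT h.
  apply: measurable_funB => //; exact: (measurableT_comp mf0).
have mh2 : measurable_fun setT (fun p => (h p ^+ 2)%:E).
  by apply/measurable_EFinP; exact: measurable_funX.
have h20 p : (0 <= (h p ^+ 2)%:E)%E by rewrite lee_fin sqr_ge0.
have [M cM] := compact_continuous_bounded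
  (compact_setX (closure_domain_compact D) (closure_domain_compact D)) cc.
have finite : (\int[P]_w \int[mu]_x (h (x, w) ^+ 2)%:E < +oo)%E.
  rewrite -(fubini_tonelli (fun p => (h p ^+ 2)%:E))//.
  apply: (@le_lt_trans _ _ (\int[mu]_x (cst `|M|%:E x))%E).
    apply: ge0_le_integral => //.
    - by move=> x _; exact: integral_ge0.
    - exact: (@measurable_fun_fubini_tonelli_F _ _ _ _ _ P _ mh2 h20).
    - move=> x _; have [Dx|Dx] := pselect (dom D x); last first.
        rewrite integral0_eq ?lee_fin// => w _.
        by rewrite /h /= !patchE memNset//= subrr expr0n.
      have -> : (\int[P]_w (h (x, w) ^+ 2)%:E = (c x x)%:E)%E.
        rewrite -covariance_sqr//; apply: eq_integral => w _.
        by rewrite /h /= !patchE mem_set.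
      rewrite lee_fin (le_trans (ler_norm _))// (le_trans _ (ler_norm M))//.
      by apply: (cM (x, x)); split; exact: subset_closure.
  by rewrite integral_cst// lte_mul_pinfty//; exact: domain_measure_lty.
have hint : P.-integrable setT (fun w => \int[mu]_x (h (x, w) ^+ 2)%:E)%E.
  apply/integrableP; split.
    exact: (@measurable_fun_fubini_tonelli_G _ _ _ _ _ mu _ mh2 h20).
  apply: le_lt_trans finite; rewrite le_eqVlt; apply/orP; left; apply/eqP.
  by apply: eq_integral => w _; rewrite gee0_abs//; exact: integral_ge0.
apply: filterS (integrable_ae measurableT hint) => w /(_ I) wfin.
rewrite (_ : _ \_ D = fun x => h (x, w) + (f0 \_ D) x); last first.
  by apply/funext => x; rewrite /h subrK.
apply: Lfun2D; last exact: Lfun2_restrict_domain.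
apply: sqr_int_Lfun2; first exact: (measurable_fun_pair1 w mh).
by rewrite -ge0_fin_numE//; exact: integral_ge0.
Qed.

Section KL_expansion.
Variables (sigma : nat -> R) (e : nat -> L2 mu) (xi : nat -> {RV P >-> R}).
Local Notation fK := (KL_truncation f0 sigma e xi).

Lemma KL_truncation_restrict K w : (fun x => fK K x w) \_ D =
  (fun x => (f0 \_ D) x + \sum_(k < K) (sigma k * xi k w) * e k x) \_ D.
Proof. by apply/funext => x; rewrite !patchE; case: ifPn. Qed.

Lemma measurable_KL_restrict K : measurable_fun setT
  (fun p : borel 'rV[R]_d * Omega => ((fun x => fK K x p.2) \_ D) p.1).
Proof.
pose F (p : borel 'rV[R]_d * Omega) :=
  (f0 \_ D) p.1 + \sum_(k < K) (sigma k * xi k p.2) * e k p.1.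
have mD : measurable ((D : set (borel 'rV[R]_d)) `*` [set: Omega]).
  by apply: measurableX => //; exact: measurable_domain.
have mF : measurable_fun setT F.
  apply: measurable_funD.
    exact: (measurableT_comp (measurable_restrict_domain f0_cont)).
  apply: measurable_sum => k; apply: measurable_funM.
    by apply: measurable_funM => //; exact: measurableT_comp.
  by apply: (measurableT_comp (measurable_L2fun (e k))).
rewrite (_ : (fun _ => _) = F \_ ((D : set (borel 'rV[R]_d)) `*` [set: Omega])).
  exact/(measurable_restrictT _ mD)/measurable_funTS.
apply/funext => -[x w]; rewrite KL_truncation_restrict !patchE.
by congr (if _ then _ else _); apply/idP/idP; rewrite !inE => //= -[].
Qed.

Hypothesis he : orthonormal_basis e.

Lemma basis_dotp : forall i j, dotp mu (e i) (e j) = (i == j)%:R.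
Proof.
by move=> i j; rewrite -he.1 inner_dotp dotp_restrict//; exact: measurable_L2fun.
Qed.

Lemma basis_complete (u : L2 mu) :
  'N[mu]_2%:E[EFin \o (fun x => u x - \sum_(k < n) dotp mu u (e k) * e k x)%R]%E
    @[n --> \oo] --> 0%E.
Proof.
have ue k : dotp mu u (e k) = inner D u (e k).
  by rewrite inner_dotp dotp_restrict//; exact: measurable_L2fun.
rewrite (_ : (fun n => _) = (fun n : nat => 'N[mu]_2%:E[EFin \o
    (fun x : 'rV[R]_d => u x - \sum_(k < n) inner D u (e k) * e k x)%R]%E)).
  exact: he.2.
apply/funext => n; congr Lnorm; apply/funext => x /=; congr (_ - _)%:E.
by apply: eq_bigr => k _; rewrite ue.
Qed.

(** This holds for every w, so that the coordinates from K on are constants, as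
    wasserstein2_coordinates requires. *)
Lemma KL_coordinate K w k : dotp mu (L2_path D (fK K) w : L2 mu) (e k) =
  dotp mu (f0 \_ D) (e k) + (if (k < K)%N then sigma k * xi k w else 0).
Proof.
pose s x := \sum_(k < K) (sigma k * xi k w) * e k x.
have sL : s \in Lfun mu 2%:E by exact: (Lfun2_comb e K (fun k => sigma k * xi k w)).
have fsL : (fun x => (f0 \_ D) x + s x) \in Lfun mu 2%:E.
  by apply: Lfun2D => //; exact: Lfun2_restrict_domain.
rewrite /L2_path KL_truncation_restrict dotp_L2class; [|exact: Lfun2_restrict|
  exact: measurable_L2fun].
rewrite (dotp_restrict (Lfun2_measurable fsL) (measurable_L2fun (e k))).
rewrite dotpDl ?L2fun_Lfun//; last exact: Lfun2_restrict_domain.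
by rewrite (dotp_span basis_dotp K (fun k => sigma k * xi k w)).
Qed.

Lemma field_coordinate k :
  (\forall w \ae P, (f ^~ w) \_ D \in Lfun mu 2%:E) ->
  KL_coefficients f f0 sigma e xi ->
  \forall w \ae P, dotp mu (L2_path D f w : L2 mu) (e k) =
    dotp mu (f0 \_ D) (e k) + sigma k * xi k w.
Proof.
move=> fL /(_ k); apply: filterS2 fL => w fwL ->.
rewrite /L2_path dotp_L2class//; last exact: measurable_L2fun.
rewrite inner_dotp.
rewrite (_ : (fun x => f x w - f0 x) \_ D =
    fun x => ((f ^~ w) \_ D) x - (f0 \_ D) x); last first.
  by apply/funext => x; rewrite !patchE; case: ifPn => // _; rewrite subrr.
have f0L := Lfun2_restrict_domain f0_cont.
by rewrite (dotpBl fwL f0L (L2fun_Lfun (e k))) addrC subrK.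
Qed.

End KL_expansion.

End field_on_domain.

Theorem proposition3p13 (R : realType) (d : nat) (hd : (0 < d)%N)
    (D : bounded_domain R d)
    (dO : measure_display) (Omega : measurableType dO) (P : probability Omega R)
    (f : 'rV[R]_d -> Omega -> R)
    (f0 : 'rV[R]_d -> R) (c : 'rV[R]_d -> 'rV[R]_d -> R)
    (hf : gaussian_random_field D P f)
    (hmean : mean_function D P f f0)
    (hcov : covariance_function D P f c)
    (f0_cont : {within closure D, continuous f0})
    (c_cont : {within closure D `*` closure D,
      continuous (fun p : 'rV[R]_d * 'rV[R]_d => c p.1 p.2)})
    (sigma : nat -> R) (e : nat -> L2 (domain_measure D))
    (he : eigenbasis c sigma e)
    (xi : nat -> {RV P >-> R})
    (hxi : iid_standard_normal xi)
    (hcoef : KL_coefficients f f0 sigma e xi)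
    (K : nat) :
  wasserstein2 (L2_law D P f) (L2_law D P (KL_truncation f0 sigma e xi K)) =
  sqrte (\sum_(K <= k <oo) (sigma k ^+ 2)%:E)%E.
Proof.
have [mf _] := hf; have [_ he' _] := he.
have eON := basis_dotp he'; have eC := basis_complete he'.
have fL := Lfun2_field mf f0_cont hmean hcov c_cont.
have coefF k := field_coordinate f0_cont k fL hcoef.
have coefK := KL_coordinate f0_cont sigma xi he' K.
pose a k := dotp (domain_measure D) (f0 \_ D) (e k).
have mF : measurable_fun setT (fun w =>
    (L2_path D f w, L2_path D (KL_truncation f0 sigma e xi K) w)
    : borel (L2 (domain_measure D) * L2 (domain_measure D))%type).
  apply: (measurable_L2_pair eON eC) => u.
    exact: (measurable_L2class_dist u (measurable_field_restrict mf)).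
  exact: (measurable_L2class_dist u (measurable_KL_restrict f0_cont sigma e xi K)).
apply: (wasserstein2_coordinates eON eC mF (a := a)).
- by move=> k w Kk; rewrite coefK ltnNge Kk addr0.
- move=> k Kk.
  have mFk : measurable_fun setT
      (fun w => dotp (domain_measure D) (L2_path D f w : L2 _) (e k)).
    apply: (measurableT_comp (measurable_dotp eON eC k)).
    exact: (measurableT_comp (@measurable_fst_borel _ _) mF).
  transitivity (\int[P]_w ((sigma k ^+ 2)%:E * (xi k w ^+ 2)%:E))%E.
    apply: ge0_ae_eq_integral => //.
    + by apply/measurable_EFinP; apply: measurable_funX; exact: measurable_funB.
    + apply: emeasurable_funM => //.
      by apply/measurable_EFinP; exact: measurable_funX.
    + by move=> w _; rewrite lee_fin sqr_ge0.
    + by move=> w _; rewrite mule_ge0// lee_fin sqr_ge0.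
    + apply: filterS (coefF k) => w -> _.
      by rewrite addrAC subrr add0r exprMn EFinM.
  rewrite ge0_integralZl ?lee_fin ?sqr_ge0//; last 2 first.
  + by apply/measurable_EFinP; exact: measurable_funX.
  + by move=> w _; rewrite lee_fin sqr_ge0.
  by rewrite standard_normal_sqr ?mule1//; exact: (hxi.1 k).
- by move=> k kK; apply: filterS (coefF k) => w ->; rewrite coefK kK.
Qed.
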